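(* Let $h\in\mathbb{R}[x_1,\dots,x_n]$ be a homogeneous, multiaffine and stable polynomial and $e=(1,\dots,1)$ the all-ones vector. If $\frac{\partial h}{\partial x_k}\neq 0$ and the hyperbolicity cone $C_h(e)$ is spectrahedral, then the hyperbolicity cone $C_{\partial h/\partial x_k}(e)$ is also spectrahedral.
   Context: A nonzero polynomial $f\in\mathbb{C}[x_1,\dots,x_n]$ is stable if $f(x)\ne0$ whenever $\operatorname{Im}(x_i)>0$ for all $i$. A polynomial is multiaffine if it has degree at most one in each variable. A polynomial $h$ is hyperbolic with respect to $e\in\mathbb{R}^n$ if $h(e)\neq0$ and for all $v\in\mathbb{R}^n$ the univariate polynomial $h(v-te)\in\mathbb{R}[t]$ has only real roots; its hyperbolicity cone is $C_h(e)=\{v\in\mathbb{R}^n: h(v-te)=0\Rightarrow t\in\mathbb{R}_{\ge0}\}$. Every homogeneous real stable polynomial is hyperbolic with respect to the all-ones vector. A spectrahedral cone is a set of the form $\{v\in\mathbb{R}^n: v_1A_1+\dots+v_nA_n\succeq 0\}$ for real symmetric $d\times d$ matrices $A_1,\dots,A_n$, where $\succeq0$ means positive semidefinite. *)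

(* Defs.v *)
From mathcomp Require Import all_boot all_order all_algebra.
From mathcomp Require Import sesquilinear.
From mathcomp Require Import classical_sets reals.
From mathcomp Require Import mpoly complex.

Set Implicit Arguments.
Unset Strict Implicit.
Unset Printing Implicit Defensive.

Import Order.TTheory GRing.Theory Num.Theory.

Local Open Scope classical_set_scope.
Local Open Scope ring_scope.

Definition multiaffine (R : realType) (n : nat) (h : {mpoly R[n]}) : Prop :=
  forall m : 'X_{1..n}, m \in msupp h -> forall i : 'I_n, (m i <= 1)%N.

Definition complexify (R : realType) (n : nat) (h : {mpoly R[n]}) :
    {mpoly R[i][n]} :=
  map_mpoly (real_complex R) h.

Definition stable (R : realType) (n : nat) (f : {mpoly R[i][n]}) : Prop :=
  f != 0 /\
  forall x : 'I_n -> R[i], (forall i : 'I_n, 0 < complex.Im (x i)) ->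
    f.@[x] != 0.

Definition ones (R : realType) (n : nat) : 'rV[R]_n := const_mx 1.

(* The roots [t] of [h (v - t e)] range over the complex numbers. In [R[i]],
   [0 <= t] means that [t] is real and nonnegative (see [lecE]). The definition
   is only meaningful when [h] is hyperbolic with respect to [e]. *)
Definition hyperbolicity_cone (R : realType) (n : nat) (h : {mpoly R[n]})
    (e : 'rV[R]_n) : set 'rV[R]_n :=
  [set v | forall t : R[i],
    (complexify h).@[fun i => real_complex R (v 0 i)
                              - t * real_complex R (e 0 i)] = 0 ->
    0 <= t].

Definition psdmx (R : realType) (d : nat) (M : 'M[R]_d) : Prop :=
  M \is symmetricmx /\ forall x : 'cV[R]_d, 0 <= (x^T *m M *m x) 0 0.

Definition spectrahedral_cone (R : realType) (n : nat) (C : set 'rV[R]_n) :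
    Prop :=
  exists (d : nat) (A : 'I_n -> 'M[R]_d),
    (forall i : 'I_n, A i \is symmetricmx) /\
    C = [set v | psdmx (\sum_(i < n) v 0 i *: A i)].

(* Main.v *)
(* Write [h = x_k * g + f] with [g = dh/dx_k], and let [A(v) >= 0] represent the
   hyperbolicity cone of [h]. All [A_i] are positive semidefinite, because the
   cone contains the coordinate vectors. The cone of [g] is the closure of the
   projection of the cone of [h] along [e_k]: [v] lies in it iff for every
   [eps > 0] the point [v + eps e + s e_k] lies in the cone of [h] for large
   [s]. Moving infinitely far in the direction of the semidefinite matrix [A_k]
   leaves only the condition that [A(v)] be positive semidefinite on [ker A_k],
   so the compressions of the [A_i] to [ker A_k] represent the cone of [g]. The
   passages to the limit [s -> oo] on the polynomial side use Hurwitz's theorem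
   for the pencils [g + s^-1 h]. *)
Require Import Defs.
From mathcomp Require Import all_boot all_order all_algebra.
From mathcomp Require Import sesquilinear.
From mathcomp Require Import classical_sets reals.
From mathcomp Require Import mpoly complex polyrcf.
From mathcomp Require Import ring lra.

Import Order.TTheory GRing.Theory Num.Theory.
Local Open Scope ring_scope.

(** * Hurwitz's theorem for polynomial pencils *)

(** Induction on the size: splitting off a root [r] gives [P = Q * (X - r)] with [|r| >= eta] and
    [|P(0)| = |Q(0)| |r|]. That [K] depends only on [eta] and [m] takes the place of a compactness
    argument in Hurwitz's theorem. *)
Lemma coef_le_horner0 (C : numClosedFieldType) (eta : C) (m : nat) : 0 < eta ->
  exists2 K, 0 <= K & forall P : {poly C}, (size P <= m)%N ->
    (forall t, `|t| < eta -> P.[t] != 0) -> forall j, `|P`_j| <= K * `|P.[0]|.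
Proof.
move=> eta0; elim: m => [|m [K K0 IH]].
  exists 0 => // P; rewrite leqn0 size_poly_eq0 => /eqP -> _ j.
  by rewrite coef0 normr0 mul0r.
(* The factor [eta^-1 + 1] absorbs the two parts of the coefficient [Q_(j-1) - r Q_j], since
   [1 <= |r| / eta]; the last [1] covers constant [P]. *)
exists (K * (eta^-1 + 1) + 1) => [|P sP nzP j].
  by rewrite addr_ge0 ?mulr_ge0 ?addr_ge0 ?invr_ge0 // ltW.
have [|nP] := boolP (size P == 1%N).
  move=> /size_poly1P[c _ ->]; rewrite coefC hornerC.
  apply: (@le_trans _ _ `|c|); first by case: (j == 0)%N; rewrite ?normr0.
  by rewrite mulrDl mul1r lerDr !mulr_ge0 ?addr_ge0 ?invr_ge0 // ltW.
have [r /factor_theorem[Q PQ]] := closed_rootP _ nP.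
have Qnz t : `|t| < eta -> Q.[t] != 0.
  by move=> /nzP; rewrite PQ hornerM mulf_eq0 negb_or => /andP[].
have Q0 : Q != 0.
  by apply/eqP => q0; have := Qnz 0; rewrite normr0 q0 horner0 eqxx => /(_ eta0).
have sQ : (size Q <= m)%N.
  by move: sP; rewrite PQ size_Mmonic ?monicXsubC // size_XsubC addn2.
have r_ge : eta <= `|r|.
  rewrite real_leNgt ?normr_real ?gtr0_real //; apply/negP => /nzP.
  by rewrite PQ hornerM !hornerE subrr mulr0 eqxx.
have r0 : 0 < `|r| by exact: lt_le_trans r_ge.
have bQ := IH Q sQ Qnz.
have -> : `|P.[0]| = `|Q.[0]| * `|r|.
  by rewrite PQ hornerM hornerXsubC sub0r normrM normrN.
have -> : P`_j = (if j is j'.+1 then Q`_j' else 0) - Q`_j * r.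
  by rewrite PQ mulrBr coefB coefMX coefMC; case: j.
apply: (le_trans (ler_normB _ _)); rewrite normrM.
apply: (@le_trans _ _ (K * `|Q.[0]| + K * `|Q.[0]| * `|r|)).
  apply: lerD; last by apply: ler_wpM2r.
  by case: j => [|j]; [rewrite normr0 mulr_ge0 | exact: bQ].
rewrite -[X in X + _]mulr1 -mulrDr [_ + 1]addrC mulrDl mul1r.
apply: (@le_trans _ _ (K * (eta^-1 + 1) * (`|Q.[0]| * `|r|))).
  rewrite -!mulrA ler_wpM2l // mulrCA ler_wpM2l // mulrDl mul1r lerD2r.
  by rewrite mulrC -ler_pdivrMr ?invr_gt0 // div1r invrK.
by rewrite lerDr mulr_ge0.
Qed.

(** Translating the variable preserves the size, so one constant serves all centres [t0]. *)
Lemma coef_shift_le_horner (C : numClosedFieldType) (eta : C) (m : nat) :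
  0 < eta ->
  exists2 K, 0 <= K & forall (P : {poly C}) t0, (size P <= m)%N ->
    (forall t, `|t - t0| < eta -> P.[t] != 0) ->
    forall j, `|(P \Po ('X + t0%:P))`_j| <= K * `|P.[t0]|.
Proof.
move=> eta0; have [K K0 bK] := @coef_le_horner0 _ _ m eta0.
exists K => // P t0 sP nzP j.
have := bK (P \Po ('X + t0%:P)); rewrite horner_comp !hornerE; apply.
  by rewrite size_comp_poly2 // size_XaddC.
by move=> t t_lt; rewrite horner_comp !hornerE nzP // addrK.
Qed.

(** If [p(t0) = 0], then [p + delta q] is [O(delta)] at [t0], so by the uniform bound all its
    coefficients about [t0] are [O(delta)]. As [delta] tends to 0 this forces [p = 0]. *)
Lemma hurwitz (C : numClosedFieldType) (p q : {poly C}) (t0 eta : C) :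
  p != 0 -> 0 < eta ->
  (forall c, 0 < c -> exists2 delta, 0 < delta <= c &
     forall t, `|t - t0| < eta -> (p + delta *: q).[t] != 0) ->
  p.[t0] != 0.
Proof.
move=> p0 eta0 nz; apply: contra_neqN p0 => /eqP pt0.
pose m := maxn (size p) (size q).
have [K K0 bK] := @coef_shift_le_horner _ _ m eta0.
suff p'0 : p \Po ('X + t0%:P) = 0.
  by apply/eqP; rewrite -(comp_poly2_eq0 p (q := 'X + t0%:P)) ?size_XaddC ?p'0.
apply/polyP => j; rewrite coef0; apply/eqP; apply: contraT => pj0.
set a := (p \Po _)`_j in pj0; set b := (q \Po ('X + t0%:P))`_j.
(* Chosen so that [delta <= |a| / B] gives the contradiction [|a| <= delta (K |q(t0)| + |b|) < delta
   B <= |a|]. *)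
pose B := K * `|q.[t0]| + `|b| + 1.
have B0 : 0 < B by rewrite ltr_wpDl // addr_ge0 // mulr_ge0.
have a0 : 0 < `|a| by rewrite normr_gt0.
have [delta /andP[d0 d_le] nzd] := nz (`|a| / B) (divr_gt0 a0 B0).
have sd : (size (p + delta *: q)%R <= m)%N.
  by rewrite (leq_trans (size_polyD _ _)) // geq_max leq_maxl /=
             (leq_trans (size_scale_leq _ _)) // leq_maxr.
have := bK _ _ sd nzd j.
rewrite comp_polyD comp_polyZ coefD coefZ -/a -/b !hornerE pt0 add0r.
rewrite normrM gtr0_norm // => le1.
have : `|a| < `|a|; last by rewrite ltxx.
have -> : a = (a + delta * b) - delta * b by rewrite addrK.
apply: (le_lt_trans (ler_normB _ _)); rewrite normrM (gtr0_norm d0).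
rewrite addrK; apply: le_lt_trans (_ : delta * (K * `|q.[t0]| + `|b|) < _).
  by rewrite mulrDr lerD2r mulrCA.
apply: (@lt_le_trans _ _ (delta * B)); last by rewrite -ler_pdivlMr.
by rewrite ltr_pM2l // ltrDl.
Qed.

(** Translation fixes the leading coefficient, so [|P(t0)|] is bounded below uniformly, even over an
    unbounded set of centres. *)
Lemma lead_coef_le_horner (C : numClosedFieldType) (P : {poly C}) (eta : C) :
  0 < eta -> exists2 K, 0 <= K &
    forall t0, (forall t, `|t - t0| < eta -> P.[t] != 0) ->
    `|lead_coef P| <= K * `|P.[t0]|.
Proof.
move=> eta0; have [K K0 bK] := @coef_shift_le_horner _ _ (size P) eta0.
exists K => // t0 nz; have := bK P t0 (leqnn _) nz (size P).-1.
rewrite -[X in _`_X.-1](size_comp_poly2 P (size_XaddC t0)) -/(lead_coef _).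
by rewrite lead_coef_comp ?size_XaddC // lead_coefXaddC expr1n mulr1.
Qed.

(** * Positive semidefinite forms *)

Definition bform {R : realType} {d : nat} (A : 'M[R]_d) (x y : 'cV[R]_d) : R :=
  (x^T *m A *m y) 0 0.

Section QuadraticForms.

Context {R : realType} {d : nat}.
Implicit Types (A B K : 'M[R]_d) (x y z : 'cV[R]_d).

Lemma symmetricmxP A : reflect (A^T = A) (A \is symmetricmx).
Proof.
apply: (iffP (is_hermitianmxP _ _ _)); rewrite expr0 scale1r map_mx_id //.
Qed.

Lemma bformDl A x y z : bform A (x + y) z = bform A x z + bform A y z.
Proof. by rewrite /bform linearD !mulmxDl mxE. Qed.

Lemma bformDr A x y z : bform A x (y + z) = bform A x y + bform A x z.
Proof. by rewrite /bform mulmxDr mxE. Qed.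

Lemma bformZl A a x y : bform A (a *: x) y = a * bform A x y.
Proof. by rewrite /bform linearZ -!scalemxAl mxE. Qed.

Lemma bformZr A a x y : bform A x (a *: y) = a * bform A x y.
Proof. by rewrite /bform -scalemxAr mxE. Qed.

Lemma bformC A x y : A \is symmetricmx -> bform A x y = bform A y x.
Proof.
move=> /symmetricmxP AT; rewrite /bform.
have -> : y^T *m A *m x = (x^T *m A *m y)^T.
  by rewrite !trmx_mul trmxK AT mulmxA.
by rewrite [RHS]mxE.
Qed.

Lemma bform_sum (I : finType) (a : I -> R) (A : I -> 'M[R]_d) x y :
  bform (\sum_i a i *: A i) x y = \sum_i a i * bform (A i) x y.
Proof.
rewrite /bform mulmx_sumr mulmx_suml summxE; apply: eq_bigr => i _.
by rewrite -scalemxAr -scalemxAl mxE.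
Qed.

Lemma symmetricmx_sum (I : finType) (a : I -> R) (A : I -> 'M[R]_d) :
  (forall i, A i \is symmetricmx) -> \sum_i a i *: A i \is symmetricmx.
Proof.
move=> As; apply/symmetricmxP; rewrite linear_sum; apply: eq_bigr => i _.
by rewrite linearZ /=; move/symmetricmxP: (As i) ->.
Qed.

Lemma psdmx_bform A a b x y : psdmx A ->
  0 <= a ^+ 2 * bform A x x + 2 * a * b * bform A x y + b ^+ 2 * bform A y y.
Proof.
move=> [As /(_ (a *: x + b *: y))]; rewrite -/(bform _ _ _).
rewrite !(bformDl, bformDr, bformZl, bformZr) (bformC _ y x As).
by congr (_ <= _); ring.
Qed.

Lemma bform_le_sqr_norm A :
  exists2 c, 0 <= c & forall x, bform A x x <= c * \sum_i x i 0 ^+ 2.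
Proof.
exists (\sum_i \sum_j `|A i j|) => [|x].
  by do 2!apply: sumr_ge0 => ? _.
have sq i : x i 0 ^+ 2 <= \sum_i x i 0 ^+ 2.
  by rewrite (bigD1 i) //= lerDl sumr_ge0 // => j _; rewrite sqr_ge0.
have -> : bform A x x = \sum_i \sum_j x i 0 * A i j * x j 0.
  rewrite /bform mxE exchange_big; apply: eq_bigr => j _.
  by rewrite mxE mulr_suml; apply: eq_bigr => i _; rewrite mxE.
rewrite mulr_suml; apply: ler_sum => i _; rewrite mulr_suml.
apply: ler_sum => j _; apply: (le_trans (ler_norm _)).
rewrite mulrAC mulrC normrM ler_wpM2l //.
have := sq i; have := sq j; set s := \sum_(_ | _) _ => sj si.
rewrite ler_norml; apply/andP; split.
  by have := sqr_ge0 (x i 0 + x j 0); nra.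
by have := sqr_ge0 (x i 0 - x j 0); nra.
Qed.

(** Cauchy-Schwarz for the form [K], since [(K x)_i = K(e_i, x)]. *)
Lemma psdmx_sqr_mulmx_le K x i : psdmx K ->
  (K *m x) i 0 ^+ 2 <= K i i * bform K x x.
Proof.
move=> Kpsd; pose e : 'cV[R]_d := delta_mx i 0.
have eK : e^T *m K = row i K by rewrite trmx_delta -rowE.
have Kex : bform K e x = (K *m x) i 0.
  by rewrite /bform eK -row_mul mxE.
have Kee : bform K e e = K i i.
  by rewrite /bform eK -colE !mxE.
have H a b := psdmx_bform K a b e x Kpsd.
rewrite Kex Kee in H.
have Kii : 0 <= K i i by have := H 1 0; nra.
have Kxx : 0 <= bform K x x by have := H 0 1; nra.
have [K0|K0] := eqVneq (K i i) 0.
  (* For [K_ii = 0] the form takes the value [-(K(x, x) + 2) (K x)_i ^ 2] here, so [(K x)_i = 0]. *)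
  have := H (- (bform K x x + 1)) ((K *m x) i 0); rewrite K0; nra.
have {}K0 : 0 < K i i by rewrite lt0r K0.
have := H ((K *m x) i 0) (- K i i).
suff -> : forall a b c : R, a ^+ 2 * b + 2 * a * - b * a + (- b) ^+ 2 * c =
    b * (b * c - a ^+ 2) by rewrite pmulr_rge0 // subr_ge0.
by move=> a b c; ring.
Qed.

(** With a generalized inverse, [Z x] is a linear function of [K x], whose squared norm is at most
    [tr K * K(x, x)]. So [x - Z x] lies in [ker K], and [K(x, x)] controls every form at [Z x]. *)
Lemma psdmx_ker_projection K : psdmx K -> exists2 Z : 'M[R]_d, K *m Z = K &
  forall B, exists2 c, 0 <= c &
    forall x, bform B (Z *m x) (Z *m x) <= c * bform K x x.
Proof.
move=> Kpsd; exists (pinvmx K *m K); first by rewrite mulmxA mulmxKpV.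
move=> B; have [c c0 bc] := bform_le_sqr_norm ((pinvmx K)^T *m B *m pinvmx K).
have trK0 : 0 <= \tr K.
  rewrite sumr_ge0 // => i _; have [_ /(_ (delta_mx i 0))] := Kpsd.
  by rewrite trmx_delta -rowE -colE !mxE.
exists (c * \tr K); first by rewrite mulr_ge0.
move=> x; have := bc (K *m x); rewrite /bform !trmx_mul !mulmxA => le1.
apply: (le_trans le1); rewrite -mulrA ler_wpM2l // mulr_suml.
by apply: ler_sum => i _; exact: psdmx_sqr_mulmx_le.
Qed.

End QuadraticForms.

(** Split [x] along [ker A_k]: the terms [eps A_i] absorb the cross terms, and [s A_k] dominates
    what is left off the kernel. *)
Lemma psdmx_sum_eventually {R : realType} {n d : nat} (A : 'I_n -> 'M[R]_d)
    (k : 'I_n) (v : 'I_n -> R) (eps : R) :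
  (forall i, psdmx (A i)) ->
  (forall x, A k *m x = 0 -> 0 <= bform (\sum_i v i *: A i) x x) ->
  0 < eps ->
  exists s0, forall s, s0 <= s ->
    psdmx (\sum_i (v i + eps + s * (i == k)%:R) *: A i).
Proof.
move=> Apsd vker eps0; have [Z AkZ bZ] := psdmx_ker_projection (A k) (Apsd k).
have [c c0 cP] := fin_all_exists2 (fun i => bZ (A i)).
(* For [x = y + z] with [y] in [ker A_k], the cross term [2 w_i A_i(y, z)] is
   bounded below by [- eps A_i(y, y) - (w_i ^ 2 / eps) A_i(z, z)]. *)
pose w i := v i + eps; pose a i := w i - w i ^+ 2 / eps.
(* Each [a_i A_i(z, z)] is at least [-|a_i| c_i A_k(x, x)], so [s A_k(x, x)] outweighs their sum. *)
exists (\sum_i `|a i| * c i) => s s_ge; split.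
  by apply: symmetricmx_sum => i; case: (Apsd i).
move=> x; rewrite -/(bform _ x x) bform_sum.
under eq_bigr => i _ do rewrite mulrDl.
rewrite big_split /= [X in _ + X](bigD1 k) //= eqxx mulr1.
rewrite [X in _ + (_ + X)]big1 ?addr0; last first.
  by move=> i /negPf ->; rewrite mulr0 mul0r.
set q := bform (A k) x x.
have q0 : 0 <= q by case: (Apsd k) => _; apply.
pose z := Z *m x; pose y := x - z.
have xE : x = y + z by rewrite subrK.
have := vker y; rewrite mulmxBr mulmxA AkZ subrr bform_sum => /(_ erefl) vy.
have cz i : bform (A i) z z <= c i * q := cP i x.
clearbody y; clearbody z.
have le1 i : v i * bform (A i) y y - `|a i| * c i * q <=
             w i * bform (A i) x x.
  have le2 : - (`|a i| * c i * q) <= a i * bform (A i) z z.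
    rewrite lerNl -mulNr; apply: (le_trans (ler_norm _)).
    rewrite normrM normrN -mulrA ler_wpM2l // ger0_norm ?cz //.
    by case: (Apsd i) => _; apply.
  apply: (le_trans (lerD (lexx _) le2)); rewrite xE.
  have [As _] := Apsd i.
  rewrite bformDl !bformDr (bformC _ z y As).
  (* The difference of the two sides, times [eps], is the form [A_i] at [eps y + w_i z]. *)
  have := psdmx_bform (A i) eps (w i) y z (Apsd i).
  set yy := bform _ y y; set yz := bform _ y z; set zz := bform _ z z => ge0.
  rewrite -subr_ge0 -(pmulr_rge0 _ eps0); move: ge0; congr (_ <= _).
  by rewrite /a /w; field; rewrite gt_eqF.
have le3 := ler_sum (index_enum 'I_n) (fun i (_ : true) => le1 i).
rewrite sumrB -mulr_suml in le3.
have : (\sum_i `|a i| * c i) * q <= s * q by rewrite ler_wpM2r.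
by rewrite -/(w _) in le3 *; move: le3 vy; rewrite /w; lra.
Qed.

(** * Evaluation of multivariate polynomials *)

Section Evaluation.

Context {C : comNzRingType} {n : nat}.
Implicit Types (p : {mpoly C[n]}) (x w : 'I_n -> C).

Lemma meval_dhomog d p c x : p \is d.-homog ->
  p.@[fun i => c * x i] = c ^+ d * p.@[x].
Proof.
move=> /dhomogP ph; rewrite !mevalE mulr_sumr; apply: eq_big_seq => m /ph <-.
rewrite mulrCA; congr (_ * _); rewrite /= mdegE -prodrXr -big_split /=.
by apply: eq_bigr => i _; rewrite exprMn.
Qed.

(** As [p] is affine in [x_k], its first-order Taylor expansion along [e_k] is exact. *)
Lemma meval_shift_multiaffine p (k : 'I_n) s x :
  (forall m, m \in msupp p -> (m k <= 1)%N) ->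
  p.@[fun i => x i + s * (i == k)%:R] = p.@[x] + s * (p^`M(k)).@[x].
Proof.
move=> pk; rewrite [p in RHS]mpolyE [p in LHS]mpolyE [in RHS](linear_sum (mderiv k)).
rewrite !raddf_sum /= mulr_sumr -big_split /=.
apply: eq_big_seq => m /pk mk.
rewrite mderivZ mderivX !mevalZ !mevalX mulrCA -mulrDr; congr (_ * _).
rewrite (bigD1 k) //= [in RHS](bigD1 k) //= [X in _ + _ * (_ * X)](bigD1 k) //=.
set A := \prod_(_ | _) _; set B := \prod_(_ | _) _; set D := \prod_(_ | _) _.
have -> : A = B by apply: eq_bigr => i /negPf ik; rewrite ik mulr0 addr0.
have -> : D = B.
  by apply: eq_bigr => i ik; rewrite mnmBE mnm1E eq_sym (negPf ik) subn0.
rewrite mnmBE mnm1E !eqxx mulr1; case: (m k) mk => [|[|//]] _.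
  by rewrite !expr0 mul0r mulr0 addr0.
by rewrite subnn !expr1 expr0 !mul1r mulrDl.
Qed.

Lemma dhomog_mderiv d p k : p \is d.-homog -> p^`M(k) \is d.-1.-homog.
Proof.
move=> /dhomogP ph; apply/dhomogP => m.
rewrite mcoeff_msupp mcoeff_mderiv => pm; have := ph (m + U_(k))%MM.
rewrite mcoeff_msupp; have [p0|_] := eqVneq p@_(m + U_(k)) 0.
  by rewrite p0 mul0rn eqxx in pm.
by move=> /(_ isT) <-; rewrite /= mdegD mdeg1 addn1.
Qed.

Definition line_poly p x w : {poly C} :=
  mmap (@polyC C) (fun i => (x i)%:P + w i *: 'X) p.

Lemma horner_line_poly p x w t :
  (line_poly p x w).[t] = p.@[fun i => x i + t * w i].
Proof.
rewrite /line_poly mevalE /mmap horner_sum; apply: eq_bigr => m _.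
rewrite hornerM hornerC horner_prod; congr (_ * _); apply: eq_bigr => i _.
by rewrite horner_exp hornerD hornerC hornerZ hornerX mulrC.
Qed.

End Evaluation.

(** Turns a large shift [s] along [e_k] into a small perturbation [delta = s^-1] of the derivative,
    the form required by [hurwitz]. *)
Lemma meval_shift_pencil (C : fieldType) n (p : {mpoly C[n]}) (k : 'I_n) x w s t :
  (forall m, m \in msupp p -> (m k <= 1)%N) -> s != 0 ->
  p.@[fun i => x i + t * w i + s * (i == k)%:R] =
  s * (line_poly p^`M(k) x w + s^-1 *: line_poly p x w).[t].
Proof.
move=> pk s0; rewrite (meval_shift_multiaffine _ _ _ (fun i => x i + t * w i)) //.
rewrite hornerD hornerZ !horner_line_poly mulrDr mulrA divff // mul1r.
by rewrite addrC.
Qed.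

Lemma multiaffine_dhomog_meval_neq0 (C : idomainType) n d (p : {mpoly C[n]}) :
  p \is d.-homog -> (forall m, m \in msupp p -> forall i, (m i <= 1)%N) ->
  p != 0 -> exists y, p.@[y] != 0.
Proof.
move=> /dhomogP ph pm p0; pose m := mlead p.
have mp : m \in msupp p by exact: mlead_supp.
(* At the indicator vector of a monomial of [p], every other monomial of the
   same degree vanishes. *)
exists (fun i => (m i)%:R); rewrite mevalE (bigD1_seq m) ?msupp_uniq //=.
rewrite [X in _ + X]big1_seq ?addr0; last first.
  move=> m' /andP[m'm m'p]; apply/eqP. rewrite mulf_eq0; apply/orP; right.
  (* Otherwise [m' <= m] entrywise, and equal degrees would give [m' = m]. *)
  suff [i mi m'i] : exists2 i, m i = 0%N & m' i = 1%N.
    by rewrite (bigD1 i) //= mi m'i expr1 mul0r.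
  have [/existsP[i /andP[/eqP ? /eqP ?]]|/existsPn nex] :=
    boolP [exists i, (m i == 0%N) && (m' i == 1%N)]; first by exists i.
  have le i : (m' i <= m i)%N.
    have := nex i; have := pm _ m'p i; have := pm _ mp i.
    by case: (m i) => [|[|]]; case: (m' i) => [|[|]].
  suff /eqP : m' = m by rewrite (negPf m'm).
  apply/mnmP => i; have := ph _ m'p; rewrite -(ph _ mp) /= !mdegE => /eqP.
  by rewrite (leqif_sum (fun i _ => leqif_eq (le i))) => /forallP/(_ i)/eqP.
rewrite mulf_neq0 //; first by rewrite -mcoeff_msupp.
apply/prodf_neq0 => i _; have := pm _ mp i.
by case: (m i) => [|[|]] // _; rewrite ?expr0 ?expr1 oner_eq0.
Qed.

Section Complexification.

Context {R : realType} {n : nat}.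
Implicit Types (f : {mpoly R[n]}) (v x : 'I_n -> R).

Lemma complexify_mderiv f k : complexify (f^`M(k)) = (complexify f)^`M(k).
Proof.
apply/mpolyP => m; rewrite mcoeff_mderiv !mcoeff_map_mpoly mcoeff_mderiv.
by rewrite raddfMn.
Qed.

Lemma mem_msupp_complexify f m : (m \in msupp (complexify f)) = (m \in msupp f).
Proof. by rewrite (perm_mem (msupp_map_mpoly f (@complexI R))). Qed.

Lemma dhomog_complexify d f : f \is d.-homog -> complexify f \is d.-homog.
Proof.
by move=> /dhomogP fh; apply/dhomogP => m; rewrite mem_msupp_complexify => /fh.
Qed.

Lemma meval_complexify f v :
  (complexify f).@[fun i => real_complex R (v i)] = real_complex R f.@[v].
Proof.
rewrite !mevalE (perm_big _ (msupp_map_mpoly f (@complexI R))) rmorph_sum /=.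
apply: eq_bigr => m _; rewrite mcoeff_map_mpoly rmorphM rmorph_prod /=.
by congr (_ * _); apply: eq_bigr => i _; rewrite rmorphXn.
Qed.

End Complexification.

(** * Stable polynomials *)

Section Stability.

Local Open Scope complex_scope.

Lemma normc_ge_Im {R : rcfType} (z : R[i]) : `|complex.Im z|%:C <= `|z|.
Proof.
have := normc_ge_Re (z * 'i%C); rewrite ReiNIm normrN => /le_trans; apply.
by rewrite normrM complexiE normCi mulr1.
Qed.

Lemma Im_add {R : rcfType} (z w : R[i]) :
  complex.Im (z + w) = complex.Im z + complex.Im w.
Proof. by case: z w => [a b] [c d]. Qed.

Context {R : realType} {n : nat}.
Implicit Types (f : {mpoly R[n]}) (F : {mpoly R[i][n]}) (v x y : 'I_n -> R).

(* Stability is stated for [Im > 0]; multiplying by [-1] covers [Im < 0]. *)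
Lemma stable_root_real F d v t : F \is d.-homog -> stable F ->
  F.@[fun i => (v i)%:C + t] = 0 -> complex.Im t = 0.
Proof.
move=> Fh [_ Fs] Ft; case: (ltrgtP (complex.Im t) 0) => // t0; exfalso.
  have tx i : 0 < complex.Im (-1 * ((v i)%:C + t)).
    by rewrite mulN1r; case: t t0 {Ft} => a b /= b0; rewrite add0r oppr_gt0.
  by have := Fs _ tx; rewrite (meval_dhomog _ _ _ _ Fh) Ft mulr0 eqxx.
have tx i : 0 < complex.Im ((v i)%:C + t).
  by case: t t0 {Ft} => a b /= b0; rewrite add0r.
by have := Fs _ tx; rewrite Ft eqxx.
Qed.

(** The point [i x] has positive imaginary parts, and homogeneity pulls out the factor [i]. *)
Lemma stable_meval_pos_neq0 f d x : f \is d.-homog -> stable (complexify f) ->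
  (forall i, 0 < x i) -> f.@[x] != 0.
Proof.
move=> fh [_ fs] x0; have ix i : 0 < complex.Im ('i%C * (x i)%:C) by rewrite /= mul0r mul1r add0r.
have := fs _ ix; rewrite (meval_dhomog _ _ _ _ (dhomog_complexify _ _ fh)).
by apply: contraNneq => f0; rewrite meval_complexify f0 mulr0.
Qed.

(** Stability and homogeneity already make all roots real, so only their sign remains to be tested;
    the parameter changes sign from [u - t e] to [u + t e]. *)
Lemma hyperbolicity_coneP f d (u : 'rV[R]_n) :
  f \is d.-homog -> stable (complexify f) ->
  hyperbolicity_cone f (ones R n) u <->
  forall t, 0 < t -> f.@[fun i => u 0 i + t] != 0.
Proof.
move=> fh fs; split=> [uC t t0|unz t].
  apply/eqP => ft0; have := uC (- t%:C).
  rewrite -(@meval_eq _ _ (fun i => (u 0 i + t)%:C)); last first.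
    by move=> i; rewrite mxE mulr1 opprK rmorphD.
  rewrite meval_complexify ft0 => /(_ erefl).
  by rewrite oppr_ge0 lecR leNgt t0.
rewrite (@meval_eq _ _ _ (fun i => (u 0 i)%:C + - t)); last first.
  by move=> i; rewrite mxE mulr1.
move=> ft; have := stable_root_real _ _ _ _ (dhomog_complexify _ _ fh) fs ft.
case: t ft => a b /= ft /eqP; rewrite oppr_eq0 => /eqP b0; subst b.
rewrite lecE /= eqxx /= leNgt; apply/negP => a0.
have := unz (- a); rewrite oppr_gt0 => /(_ a0)/negP; apply.
rewrite -(inj_eq (@complexI R)) -meval_complexify; apply/eqP.
rewrite -[RHS]ft; apply: meval_eq => i.
by rewrite rmorphD rmorphN.
Qed.

(** The derivative is the limit of [s^-1 F(x + s e_k)], and real shifts preserve imaginary parts.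
    Hurwitz's theorem is applied on the line from [x] to a point [y] where the derivative does not
    vanish. *)
Lemma stable_mderiv F d k : F \is d.-homog ->
  (forall m, m \in msupp F -> forall i, (m i <= 1)%N) ->
  stable F -> F^`M(k) != 0 -> stable F^`M(k).
Proof.
move=> Fh Fm [F0 Fs] G0; split=> // x x0.
have Gm m : m \in msupp F^`M(k) -> forall i, (m i <= 1)%N.
  rewrite mcoeff_msupp mcoeff_mderiv => mG i.
  have mF : (m + U_(k))%MM \in msupp F.
    by rewrite mcoeff_msupp; apply: contraNneq mG => ->; rewrite mul0rn.
  by have := Fm _ mF i; rewrite mnmDE; apply: leq_trans; exact: leq_addr.
have [y yG] := multiaffine_dhomog_meval_neq0 _ _ _ _ (dhomog_mderiv _ _ k Fh) Gm G0.
pose w i := y i - x i.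
have [mu mu0 mux] : exists2 mu : R, 0 < mu & forall i, mu <= complex.Im (x i).
  exists (\big[Order.min/1]_i complex.Im (x i)).
    by apply: lt_bigmin => // i _; exact: x0.
  by move=> i; exact: bigmin_le.
pose W := 1 + \sum_i `|w i|.
have W0 : 0 < W by rewrite ltr_pwDl // sumr_ge0.
have -> : (F^`M(k)).@[x] = (line_poly F^`M(k) x w).[0].
  by rewrite horner_line_poly; apply: meval_eq => i; rewrite mul0r addr0.
(* For [|t| < mu / W] every [|t w_i|] is below [mu <= Im x_i], so [x + t w] keeps positive imaginary
   parts. *)
apply: (@hurwitz _ _ (line_poly F x w) 0 (mu%:C / W)).
- apply: contraNneq yG => l0; have := horner_line_poly F^`M(k) x w 1.
  rewrite l0 horner0 => /esym/eqP; congr (_ == _); apply: meval_eq => i.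
  by rewrite mul1r addrC subrK.
- by rewrite divr_gt0 // ltcR.
move=> c c0; exists c => [|t]; first by rewrite c0 lexx.
rewrite subr0 ltr_pdivlMr // => tmu.
have tw i : 0 < complex.Im (x i + t * w i).
  have : `|t * w i| < mu%:C.
    apply: le_lt_trans tmu; rewrite normrM ler_wpM2l // /W (bigD1 i) //=.
    rewrite addrCA lerDl addr_ge0 // sumr_ge0 //.
  have := normc_ge_Im (t * w i) => /le_lt_trans/[apply]; rewrite ltcR.
  rewrite Im_add ltr_norml => /andP[+ _]; have := mux i.
  by set a := complex.Im (t * w i); lra.
have cE : c = (complex.Re c)%:C by rewrite RRe_real // gtr0_real.
have zk i : 0 < complex.Im (x i + t * w i + c^-1 * (i == k)%:R).
  rewrite Im_add cE -fmorphV -(rmorph_nat (real_complex R)) -rmorphM.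
  by rewrite addr0; exact: tw.
have := Fs _ zk; rewrite meval_shift_pencil ?invrK ?invr_eq0 ?(gt_eqF c0) //.
by rewrite mulf_eq0 negb_or => /andP[].
by move=> m /Fm.
Qed.

End Stability.

(** * Shifts in the direction [e_k] *)

Section Shifts.

Local Open Scope complex_scope.

Context {R : realType} {n : nat}.
Implicit Types (f h : {mpoly R[n]}) (v x y : 'I_n -> R).

(** A sign change would produce a zero on the segment from [x] to [y], which stays in the open
    positive orthant. *)
Lemma stable_meval_pos_mul_gt0 f d x y : f \is d.-homog ->
  stable (complexify f) -> (forall i, 0 < x i) -> (forall i, 0 < y i) ->
  0 < f.@[x] * f.@[y].
Proof.
move=> fh fs x0 y0; rewrite ltNge; apply/negP => fxy.
pose p := line_poly f x (fun i => y i - x i).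
have p0 : p.[0] = f.@[x].
  by rewrite horner_line_poly; apply: meval_eq => i; rewrite mul0r addr0.
have p1 : p.[1] = f.@[y].
  by rewrite horner_line_poly; apply: meval_eq => i; rewrite mul1r addrC subrK.
have p01 : p.[0] * p.[1] <= 0 by rewrite p0 p1.
have [a /andP[a0 a1]] := polyrcf.poly_ivt ler01 p01.
rewrite /root horner_line_poly; apply/negP.
apply: (@stable_meval_pos_neq0 _ _ _ _ _ fh fs) => i.
have := x0 i; have := y0 i; move: a0 a1; rewrite !bnd_simp.
by set xi := x i; set yi := y i; nra.
Qed.

Lemma eventually_pos v : exists2 N : R, 0 < N & forall t i, N <= t -> 0 < v i + t.
Proof.
exists (1 + \sum_i `|v i|) => [|t i]; first by rewrite ltr_pwDl // sumr_ge0.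
have : `|v i| <= \sum_i `|v i| by rewrite (bigD1 i) //= lerDl sumr_ge0.
by rewrite ler_norml => /andP[]; lra.
Qed.

Lemma horner_line_complexify f v (t : R) :
  (line_poly (complexify f) (fun i => (v i)%:C) (fun=> 1)).[t%:C] =
  (f.@[fun i => v i + t])%:C.
Proof.
rewrite horner_line_poly -meval_complexify; apply: meval_eq => i.
by rewrite mulr1 rmorphD.
Qed.

Lemma line_complexify_neq0 f d v : f \is d.-homog -> stable (complexify f) ->
  line_poly (complexify f) (fun i => (v i)%:C) (fun=> 1) != 0.
Proof.
move=> fh fs; have [N _ vN] := eventually_pos v.
have := stable_meval_pos_neq0 _ _ _ fh fs (fun i => vN N i (lexx N)).
by apply: contraNneq => l0; rewrite -(inj_eq (@complexI R)) -horner_line_complexify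
  l0 horner0.
Qed.

Lemma stable_root_real_line f d v z : f \is d.-homog -> stable (complexify f) ->
  (line_poly (complexify f) (fun i => (v i)%:C) (fun=> 1)).[z] = 0 ->
  exists2 t : R, z = t%:C & f.@[fun i => v i + t] = 0.
Proof.
move=> fh fs fz; have zE : z = (complex.Re z)%:C.
  move: fz; rewrite horner_line_poly (@meval_eq _ _ _ (fun i => (v i)%:C + z)).
    move=> /(stable_root_real _ _ _ _ (dhomog_complexify _ _ fh) fs).
    by case: z => a b /= ->.
  by move=> i; rewrite mulr1.
by exists (complex.Re z) => //; apply: complexI; rewrite -horner_line_complexify -zE.
Qed.

(** All roots along the line are real and at most 0, so the disc of radius [eps] about any
    [t >= eps] is free of zeros and [lead_coef_le_horner] applies. *)
Lemma stable_meval_lower_bound f d v eps : f \is d.-homog ->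
  stable (complexify f) -> (forall t, 0 < t -> f.@[fun i => v i + t] != 0) ->
  0 < eps ->
  exists2 c, 0 < c & forall t, eps <= t -> c <= `|f.@[fun i => v i + t]|.
Proof.
move=> fh fs fv eps0.
pose p := line_poly (complexify f) (fun i => (v i)%:C) (fun=> 1).
have epsC : 0 < eps%:C by rewrite ltcR.
have [K K0 Kp] := lead_coef_le_horner _ p _ epsC.
have p0 : p != 0 by exact: line_complexify_neq0 fh fs.
have bound t : eps <= t -> `|lead_coef p| <= K * `|(f.@[fun i => v i + t])%:C|.
  move=> t_ge; rewrite -horner_line_complexify; apply: Kp => z zt.
  apply/eqP => /(stable_root_real_line _ _ _ _ fh fs)[r zE fr].
  suff r0 : 0 < r by have := fv r r0; rewrite fr eqxx.
  move: zt; rewrite zE -rmorphB normc_def /= expr0n addr0 sqrtr_sqr ltcR.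
  by rewrite ltr_norml => /andP[+ _]; lra.
have lp0 : 0 < `|lead_coef p| by rewrite normr_gt0 lead_coef_eq0.
have normCr (r : R) : `|r%:C| = `|r|%:C.
  by rewrite normc_def /= expr0n addr0 sqrtr_sqr.
have KE : K = (complex.Re K)%:C by rewrite RRe_real // ger0_real.
have lE : `|lead_coef p| = (complex.Re `|lead_coef p|)%:C.
  by rewrite RRe_real // normr_real.
move: bound lp0 K0; rewrite lE KE; set k := complex.Re K.
set l := complex.Re _ => bound; rewrite ltcR lecR => l0 k0.
exists (l / (k + 1)) => [|t /bound]; first by rewrite divr_gt0 // ltr_wpDl.
rewrite normCr -rmorphM lecR ler_pdivrMr ?ltr_wpDl //.
by have := normr_ge0 f.@[fun i => v i + t]; nra.
Qed.

Lemma multiaffine_meval_shift h k v s : multiaffine h ->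
  h.@[fun i => v i + s * (i == k)%:R] = h.@[v] + s * (h^`M(k)).@[v].
Proof. by move=> hm; apply: meval_shift_multiaffine => m /hm. Qed.

(** Hurwitz's theorem on the disc of radius [t / 2] about [t], with [eps = t / 2]: a root there is
    real and exceeds [eps], hence is [eps + r] with [r > 0]. *)
Lemma mderiv_meval_neq0_of_shifts h d k v t :
  h \is d.-homog -> multiaffine h -> stable (complexify h) ->
  stable (complexify h^`M(k)) ->
  (forall eps, 0 < eps -> exists s0, forall s, s0 <= s -> forall r, 0 < r ->
    h.@[fun i => v i + eps + s * (i == k)%:R + r] != 0) ->
  0 < t -> (h^`M(k)).@[fun i => v i + t] != 0.
Proof.
move=> hh hm hs gs hv t0; have gh := dhomog_mderiv _ _ k hh.
have th : 0 < t / 2 by rewrite divr_gt0.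
have [s0 s0P] := hv _ th.
rewrite -(inj_eq (@complexI R)) -horner_line_complexify.
pose q := line_poly (complexify h) (fun i => (v i)%:C) (fun=> 1).
apply: (@hurwitz _ _ q _ (t / 2)%:C).
- exact: line_complexify_neq0 gh gs.
- by rewrite ltcR.
move=> c c0; have cE : c = (complex.Re c)%:C by rewrite RRe_real // gtr0_real.
move: c0; rewrite cE ltcR; set a := complex.Re c => a0.
(* Large enough for the hypothesis on shifts, and for [s^-1 <= c]. *)
pose s := Num.max s0 a^-1.
have s_gt0 : 0 < s by rewrite lt_max invr_gt0 a0 orbT.
exists (s^-1)%:C => [|z zt].
  rewrite ltcR lecR invr_gt0 s_gt0 /= -[leRHS]invrK lef_pV2 ?posrE ?invr_gt0 //.
  by rewrite le_max lexx orbT.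
apply/eqP => pq0.
pose v' i := v i + s * (i == k)%:R.
have : (line_poly (complexify h) (fun i => (v' i)%:C) (fun=> 1)).[z] = 0.
  rewrite horner_line_poly.
  rewrite (@meval_eq _ _ _ (fun i => (v i)%:C + z * 1 + s%:C * (i == k)%:R)).
    rewrite meval_shift_pencil ?fmorph_eq0 ?gt_eqF // => [|m]; last first.
      by rewrite mem_msupp_complexify => /hm.
    by rewrite -complexify_mderiv -fmorphV pq0 mulr0.
  by move=> i; rewrite /v' rmorphD rmorphM rmorph_nat addrAC.
move=> /(stable_root_real_line _ _ _ _ hh hs)[r zE hr].
move: zt; rewrite zE -rmorphB normc_def /= expr0n addr0 sqrtr_sqr ltcR.
rewrite ltr_norml => /andP[rt _].
have s_ge : s0 <= s by rewrite le_max lexx.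
have r_gt : 0 < r - t / 2 by lra.
have /eqP := s0P s s_ge _ r_gt; apply; rewrite -[RHS]hr; apply: meval_eq => i; rewrite /v'.
by ring.
Qed.

(** At [T = eps + t] the value is [h(v + T e) + s g(v + T e)], where [g] is the derivative. For
    bounded [T] the second term dominates, as [|g|] is bounded below; for larger [T] the point is
    positive, and [h] and [g] have the same sign there. *)
Lemma exists_shift_meval_neq0 h d k v eps :
  h \is d.-homog -> multiaffine h -> stable (complexify h) ->
  stable (complexify h^`M(k)) ->
  (forall t, 0 < t -> (h^`M(k)).@[fun i => v i + t] != 0) -> 0 < eps ->
  exists s, forall t, 0 < t ->
    h.@[fun i => v i + eps + s * (i == k)%:R + t] != 0.
Proof.
move=> hh hm hs gs gv eps0; have gh := dhomog_mderiv _ _ k hh.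
set g := h^`M(k) in gs gv gh *.
have [c c0 gc] := stable_meval_lower_bound _ _ _ _ gh gs gv eps0.
have [N N0 vN] := eventually_pos v.
pose q := line_poly h v (fun=> 1).
have qE t : q.[t] = h.@[fun i => v i + t].
  by rewrite horner_line_poly; apply: meval_eq => i; rewrite mulr1.
have [K qK] := poly_itv_bound q eps (N + eps).
have K0 : 0 <= K.
  by apply: le_trans (qK eps _); rewrite ?normr_ge0 // lexx lerDr ltW.
(* Makes [s c = K + 1] exceed the bound [K] of [|h|] on the bounded range. *)
pose s := (K + 1) / c; have s0 : 0 < s by rewrite divr_gt0 // ltr_wpDl.
have hg1 : 0 < h.@[fun=> 1] * g.@[fun=> 1].
  (* A sign change would give [h] a zero on the ray [e + r e_k], [r > 0]. *)
  have hne := stable_meval_pos_neq0 _ _ _ hh hs (fun=> ltr01 : 0 < 1 :> R).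
  have gne := stable_meval_pos_neq0 _ _ _ gh gs (fun=> ltr01 : 0 < 1 :> R).
  rewrite lt0r mulf_neq0 //= leNgt; apply/negP => hg.
  pose r := - (h.@[fun=> 1] / g.@[fun=> 1]).
  have r0 : 0 < r.
    rewrite /r oppr_gt0 -(pmulr_llt0 _ (_ : 0 < g.@[fun=> 1] ^+ 2)).
      by rewrite expr2 mulrA divfK.
    by rewrite lt0r sqrf_eq0 gne sqr_ge0.
  have pos i : 0 < 1 + r * (i == k)%:R.
    by rewrite ltr_pwDl // mulr_ge0 // ltW.
  have := stable_meval_pos_neq0 _ _ _ hh hs pos.
  by rewrite (multiaffine_meval_shift _ _ (fun=> 1)) // -/g /r mulNr divfK // subrr eqxx.
exists s => t t0.
rewrite (@meval_eq _ _ _ (fun i => v i + (eps + t) + s * (i == k)%:R)); last first.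
  by move=> i; ring.
rewrite (multiaffine_meval_shift _ _ (fun i => v i + (eps + t))) // -/g.
set T := eps + t; have T_ge : eps <= T by rewrite lerDl ltW.
have := gc _ T_ge; set gT := g.@[_] => cgT.
rewrite -qE; apply/eqP => hsg.
have [TN|NT] := leP T (N + eps).
  have := qK T; rewrite T_ge TN => /(_ isT); apply/negP; rewrite -ltNge.
  have -> : q.[T] = - (s * gT) by apply/eqP; rewrite -addr_eq0 hsg.
  rewrite normrN normrM gtr0_norm //.
  apply: (@lt_le_trans _ _ (s * c)); last by rewrite ler_pM2l.
  by rewrite /s divfK ?gt_eqF // ltrDl.
have posT i : 0 < v i + T by apply: vN; lra.
have hT := stable_meval_pos_mul_gt0 _ _ _ _ hh hs (fun=> ltr01 : 0 < 1 :> R) posT.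
have gT0 := stable_meval_pos_mul_gt0 _ _ _ _ gh gs (fun=> ltr01 : 0 < 1 :> R) posT.
rewrite -qE in hT; rewrite -/gT in gT0.
move: hg1 hT gT0 hsg s0; set h1 := h.@[_]; set g1 := g.@[_]; set qT := q.[T].
move=> hg1 hT gT0 hsg s0.
(* This is [h1 g1^2 (qT + s gT)], regrouped into products of values of known common sign. *)
have : 0 < (h1 * qT) * g1 ^+ 2 + s * (h1 * g1) * (g1 * gT).
  have g1_neq0 : g1 != 0 by apply: contraTneq gT0 => ->; rewrite mul0r ltxx.
  have g12 : 0 < g1 ^+ 2 by rewrite lt0r sqrf_eq0 g1_neq0 sqr_ge0.
  exact: addr_gt0 (mulr_gt0 hT g12) (mulr_gt0 (mulr_gt0 s0 hg1) gT0).
suff -> : (h1 * qT) * g1 ^+ 2 + s * (h1 * g1) * (g1 * gT) =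
  h1 * g1 ^+ 2 * (qT + s * gT) by rewrite hsg mulr0 ltxx.
by ring.
Qed.

End Shifts.

(** * Spectrahedral representations *)

(** For symmetric [K] the rows of [kermx K] span the transposes of the vectors in [ker K]. They may
    be dependent, so the compression keeps the size [d] without a choice of basis. *)
Lemma psdmx_compress {R : realType} {d : nat} (M K : 'M[R]_d) :
  K \is symmetricmx -> M \is symmetricmx ->
  psdmx (kermx K *m M *m (kermx K)^T) <->
  (forall x : 'cV[R]_d, K *m x = 0 -> 0 <= bform M x x).
Proof.
move=> /symmetricmxP Ks /symmetricmxP Ms.
have bE (N : 'M_d) x :
    (x^T *m (N *m M *m N^T) *m x) 0 0 = bform M (N^T *m x) (N^T *m x).
  by rewrite /bform trmx_mul trmxK !mulmxA.
split=> [[_ psd] x Kx|Mker].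
  have : (x^T <= kermx K)%MS.
    by apply/sub_kermxP; rewrite -Ks -trmx_mul Kx trmx0.
  move=> /submxP[D xD]; have := psd D^T; rewrite bE -trmx_mul -xD trmxK.
  exact.
split=> [|x].
  by apply/symmetricmxP; move: (kermx K) => N; rewrite !trmx_mul trmxK Ms mulmxA.
rewrite bE; apply: Mker; rewrite mulmxA.
have -> : K *m (kermx K)^T = (kermx K *m K^T)^T by rewrite [RHS]trmx_mul trmxK.
by rewrite Ks mulmx_ker trmx0 mul0mx.
Qed.

(** The vector [e_i] lies in the cone because [e_i + t e] is positive for [t > 0]; the pencil at
    [e_i] is [A_i]. *)
Lemma spectrahedral_psdmx_coef {R : realType} n d f m (A : 'I_n -> 'M[R]_m) i :
  f \is d.-homog -> stable (complexify f) ->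
  hyperbolicity_cone f (ones R n) = [set v : 'rV[R]_n | psdmx (\sum_(j < n) v 0 j *: A j)]%classic ->
  psdmx (A i).
Proof.
move=> fh fs CE.
suff : hyperbolicity_cone f (ones R n) (delta_mx 0 i).
  rewrite CE /= (bigD1 i) //= big1 => [|j ji]; last first.
    by rewrite mxE eqxx (negPf ji) scale0r.
  by rewrite mxE !eqxx scale1r addr0.
apply/(hyperbolicity_coneP _ _ _ fh fs) => t t0.
apply: (stable_meval_pos_neq0 _ _ _ fh fs) => j.
by rewrite mxE ltr_wpDl.
Qed.

Theorem theorem3p9 (R : realType) (n d : nat) (h : {mpoly R[n]}) (k : 'I_n)
  (h_homog : h \is d.-homog)
  (h_multiaffine : multiaffine h)
  (h_stable : stable (complexify h))
  (dh_neq0 : h^`M(k) != 0)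
  (h_spectrahedral : spectrahedral_cone (hyperbolicity_cone h (ones R n))) :
  spectrahedral_cone (hyperbolicity_cone h^`M(k) (ones R n)).
Proof.
case: h_spectrahedral => m [A [As CE]].
have g_homog := dhomog_mderiv _ _ k h_homog.
have g_stable : stable (complexify h^`M(k)).
  rewrite complexify_mderiv.
  apply: stable_mderiv (dhomog_complexify _ _ h_homog) _ h_stable _.
    by move=> m'; rewrite mem_msupp_complexify => /h_multiaffine.
  rewrite -complexify_mderiv; apply: contraNneq dh_neq0 => g0.
  by apply/eqP/mpolyP => m'; apply: complexI; rewrite -mcoeff_map_mpoly
    [map_mpoly _ _]g0 !mcoeff0.
have Apsd i := spectrahedral_psdmx_coef _ _ _ _ _ i h_homog h_stable CE.
have ChP w : hyperbolicity_cone h (ones R n) (\row_i w i) <->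
    psdmx (\sum_i w i *: A i).
  rewrite CE /=; suff -> : \sum_i (\row_i0 w i0) 0 i *: A i = \sum_i w i *: A i.
    by [].
  by apply: eq_bigr => i _; rewrite mxE.
exists m, (fun i => kermx (A k) *m A i *m (kermx (A k))^T); split=> [i|].
  move: (kermx (A k)) => N.
  apply/symmetricmxP; rewrite !trmx_mul trmxK.
  by move/symmetricmxP: (As i) => ->; rewrite mulmxA.
have compress_sum (N : 'M_m) (w : 'I_n -> R) :
    N *m (\sum_i w i *: A i) *m N^T = \sum_i w i *: (N *m A i *m N^T).
  rewrite mulmx_sumr mulmx_suml; apply: eq_bigr => i _.
  by rewrite -scalemxAr -scalemxAl.
apply/seteqP; split=> u /=.
all: rewrite -compress_sum.
  move=> /(hyperbolicity_coneP _ _ _ g_homog g_stable) gu.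
  apply/psdmx_compress => [||x Ax]; [exact: As | exact: symmetricmx_sum |].
  set a := bform _ x x; pose b := \sum_i bform (A i) x x.
  have b0 : 0 <= b by apply: sumr_ge0 => i _; case: (Apsd i) => _; apply.
  (* Since [A_k x = 0], the shift along [e_k] does not change the form at [x], whatever its size. *)
  have abP eps : 0 < eps -> 0 <= a + eps * b.
    move=> eps0; have [s hs] := exists_shift_meval_neq0 _ _ _ _ _ h_homog
      h_multiaffine h_stable g_stable gu eps0.
    have : hyperbolicity_cone h (ones R n)
        (\row_i (u 0 i + eps + s * (i == k)%:R)).
      apply/(hyperbolicity_coneP _ _ _ h_homog h_stable) => t /hs.
      by apply: contra => /eqP <-; apply/eqP/meval_eq => i; rewrite mxE.
    move=> /ChP[_ /(_ x)]; rewrite -/(bform _ x x) bform_sum.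
    congr (_ <= _); rewrite /a /b bform_sum mulr_sumr -big_split /=.
    apply: eq_bigr => i _; rewrite !mulrDl; case: eqVneq => [->|_].
      have -> : bform (A k) x x = 0 by rewrite /bform -mulmxA Ax mulmx0 mxE.
      by rewrite !mulr0 addr0.
    by rewrite mulr0 mul0r addr0.
  rewrite leNgt; apply/negP => a0.
  have b1 : 0 < b + 1 by rewrite ltr_wpDl.
  (* For this [eps] the sum [a + eps b] equals [a / (b + 1) < 0]. *)
  have := abP (- a / (b + 1)); rewrite divr_gt0 ?oppr_gt0 // => /(_ isT).
  apply/negP; rewrite -ltNge -(pmulr_llt0 _ b1) mulrDl mulrAC divfK ?gt_eqF //.
  by rewrite mulrDr mulr1 mulNr addrAC subrr add0r.
(* Conversely, positivity on [ker A_k] puts [u + eps e + s e_k] in the cone of [h] for all large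
   [s], and the limit in [s] gives the cone of the derivative. *)
move=> /(psdmx_compress _ _ (As k) (symmetricmx_sum _ _ _ As)) Aker.
apply/(hyperbolicity_coneP _ _ _ g_homog g_stable) => t t0.
apply: (mderiv_meval_neq0_of_shifts _ _ _ _ _ h_homog) => //.
move=> eps eps0.
have [s0 s0P] := psdmx_sum_eventually _ _ _ _ Apsd Aker eps0.
exists s0 => s /s0P /ChP /(hyperbolicity_coneP _ _ _ h_homog h_stable) hs r /hs.
by apply: contra => /eqP <-; apply/eqP/meval_eq => i; rewrite mxE.
Qed.
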